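(* For all sufficiently small $\delta>0$, with $N=\lfloor\delta^{-1}\rfloor$, consider the family of circles $$\mathcal{C}=\{C(j\delta,k\delta,\ell\delta) : j,k,\ell\in\mathbb{Z},\ 1\le j,k\le N,\ N/2\le\ell\le N\}.$$ Then $$\mathrm{card}\{(C,C')\in\mathcal{C}^2 : C\neq C',\ C,C'\text{ are tangent}\}\sim|\mathcal{C}|^{\frac43}\log|\mathcal{C}|,$$ $$\mathrm{card}\{(C,C')\in\mathcal{C}^2 : C,C'\text{ are tangent},\ d(C,C')\sim1\}\gtrsim|\mathcal{C}|^{\frac43}\log|\mathcal{C}|.$$ Moreover, the number of $1$-fold points for the family $\mathcal{C}$ is $\gtrsim|\mathcal{C}|^{\frac43}$.
   Context: $C(x,y,r)$ is the circle in $\mathbb{R}^2$ with center $(x,y)$ and radius $r$. Two distinct circles $C(x,y,r)$, $C(x',y',r')$ are called tangent if they are internally tangent, i.e. $|(x,y)-(x',y')|=|r-r'|$. Set $d(C(x,y,r),C(x',y',r'))=|(x,y)-(x',y')|+|r-r'|$. $X\gtrsim Y$ means $X\ge cY$ with an absolute constant $c>0$, $X\sim Y$ means $X\gtrsim Y$ and $Y\gtrsim X$; in particular $d(C,C')\sim1$ means that $d(C,C')$ lies between two fixed positive absolute constants. A $\mu$-fold point is a point at which between $\mu$ and $10\mu$ circles of the family are tangent to each other, counted with multiplicity: if $k$ lines through a point $Q$ each contain the centers of between $\mu$ and $10\mu$ circles of the family having $Q$ as common point of tangency, then $Q$ counts as $k$ points. Equivalently, a $\mu$-fold point is a maximal (with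 respect to inclusion) set $\{C_1,\dots,C_M\}\subset\mathcal{C}$ of circles which are all tangent to each other at one common point, with $\mu\le M\le10\mu$; for $\mu=1$ one requires $M\ge2$, so that there is a tangency. *)

(* Defs.v *)
From HB Require Import structures.
From mathcomp Require Import all_boot all_order all_algebra.
From mathcomp Require Import finmap.
From mathcomp Require Import all_classical all_reals all_analysis.

Set Implicit Arguments.
Unset Strict Implicit.
Unset Printing Implicit Defensive.
Import Order.TTheory GRing.Theory Num.Theory.
Local Open Scope classical_set_scope.
Local Open Scope ring_scope.

Definition plane (R : realType) : Type := (R * R)%type.

(* The library norm on R * R is the sup norm, hence the explicit formula. *)
Definition euclid_dist (R : realType) (P Q : plane R) : R :=
  Num.sqrt ((P.1 - Q.1) ^+ 2 + (P.2 - Q.2) ^+ 2).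

(* C(x, y, r) is encoded as ((x, y), r). For positive radii, as in the family
   below, distinct triples are distinct circles. *)
Definition circle (R : realType) : choiceType := (R * R * R)%type.

Definition mk_circle (R : realType) (x y r : R) : circle R := (x, y, r).

Definition circle_center (R : realType) (C : circle R) : plane R := C.1.

Definition circle_radius (R : realType) (C : circle R) : R := C.2.

Definition on_circle (R : realType) (Q : plane R) (C : circle R) : Prop :=
  euclid_dist Q (circle_center C) = circle_radius C.

Definition tangent (R : realType) (C C' : circle R) : Prop :=
  C <> C' /\
  euclid_dist (circle_center C) (circle_center C') =
    `|circle_radius C - circle_radius C'|.

Definition tangent_at (R : realType) (Q : plane R) (C C' : circle R) : Prop :=
  [/\ tangent C C', on_circle Q C & on_circle Q C'].

Definition circle_dist (R : realType) (C C' : circle R) : R :=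
  euclid_dist (circle_center C) (circle_center C') +
    `|circle_radius C - circle_radius C'|.

(* fset_set A is empty when A is infinite; here it is only applied to
   finite sets, see [finite_circle_family]. *)
Definition card_set (T : choiceType) (A : set T) : nat := #|` fset_set A|.

Definition commonly_tangent (R : realType) (S : set (circle R)) : Prop :=
  exists Q : plane R,
    forall C C' : circle R, S C -> S C' -> C <> C' -> tangent_at Q C C'.

(* Points are counted with multiplicity, so a point is represented by the
   maximal set of circles tangent there. Maximality is among all commonly
   tangent subfamilies, whatever their size. The condition 2 <= card_set S only
   matters for mu = 1. *)
Definition fold_point (R : realType) (F : set (circle R)) (mu : nat)
    (S : set (circle R)) : Prop :=
  [/\ S `<=` F,
      commonly_tangent S,
      forall S' : set (circle R),
        S `<=` S' -> S' `<=` F -> commonly_tangent S' -> S' = S,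
      (mu <= card_set S <= 10 * mu)%N &
      (2 <= card_set S)%N].

Definition circle_family (R : realType) (delta : R) : set (circle R) :=
  [set C | exists j k l : int,
    let N : int := Num.floor (delta^-1) in
    [/\ 1 <= j <= N, 1 <= k <= N,
        N%:~R / 2 <= (l%:~R : R) <= N%:~R &
        C = mk_circle (j%:~R * delta) (k%:~R * delta) (l%:~R * delta)]].

Lemma finite_circle_family (R : realType) (delta : R) :
  finite_set (circle_family delta).
Proof.
pose N : int := Num.floor (delta^-1).
pose I := [set n | (n < `|N|%N.+1)%N].
have fI : finite_set I by exact: finite_II.
pose f (p : nat * nat * nat) : circle R :=
  mk_circle (p.1.1%:R * delta) (p.1.2%:R * delta) (p.2%:R * delta).
apply: (@sub_finite_set _ _ (f @` ((I `*` I) `*` I))); last first.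
  by apply: finite_image; apply: finite_setX => //; exact: finite_setX.
move=> C [j [k [l]]] /=; rewrite -/N => -[/andP[j1 jN] /andP[k1 kN] /andP[l1 lN] ->].
have N0 : 0 <= N by exact: le_trans (le_trans _ j1) jN.
have l0 : 0 <= l.
  by rewrite -(ler0z R); apply: le_trans l1; rewrite divr_ge0// ler0z.
move: lN; rewrite ler_int => lN.
have hI (i : int) : 0 <= i -> i <= N -> I `|i|%N.
  by move=> i0 iN; rewrite /I /= ltnS -lez_nat !gez0_abs.
have j0 : 0 <= j by exact: le_trans j1.
have k0 : 0 <= k by exact: le_trans k1.
exists (`|j|%N, `|k|%N, `|l|%N); first by split; [split|]; exact: hI.
by rewrite /f /= !pmulrn !gez0_abs.
Qed.

(* Main.v *)
(* Write N = floor(1/delta). Tangency of C(j delta, k delta, l delta) and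
   C(j' delta, k' delta, l' delta) means that the differences (a, b, c) of the
   indices satisfy a^2 + b^2 = c^2, and |C| ~ N^3, so everything reduces to
   counting Pythagorean triples of height at most a constant times N.
   Upper bound: (c - a)(c + a) = b^2 forces c - a = g p^2, b = g p q,
   c + a = g q^2 with p <= q, and sum_q (q + 1) (2N / q^2) is O(N log N).
   Lower bound: the triples g (s^2 - t^2, 2 s t, s^2 + t^2) with s, t coprime and
   g s^2 ~ N are distinct; there are about N sum_s phi(s) / s^2 of them, and
   sum_(d | m) phi(d) = m gives sum_s phi(s) / s^2 >= H / 2 for the harmonic sum H.
   One-fold points: a primitive triple (a, b, c) with a, c ~ N, obtained from
   ~ N coprime pairs with s ~ sqrt N, and a first circle with j <= a and
   N - 2c < l <= N - c give two circles whose light ray contains no third circle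
   of the family, because the lattice points on it are spaced by exactly (a, b, c). *)

Require Import Defs.
From HB Require Import structures.
From mathcomp Require Import all_boot all_order all_algebra finmap cyclic zify ring lra.
From mathcomp Require Import all_classical all_reals all_analysis.

Set Implicit Arguments.
Unset Strict Implicit.
Unset Printing Implicit Defensive.
Import Order.TTheory GRing.Theory Num.Theory.

(** * Pythagorean triples *)

Lemma nat_sqrt (K : nat) : exists M, M ^ 2 <= K < M.+1 ^ 2.
Proof.
elim: K => [|K [M /andP[lo hi]]]; first by exists 0.
have [h|h] := ltnP K.+1 (M.+1 ^ 2); first by exists M; rewrite h andbT ltnW.
by exists M.+1; rewrite h /= (leq_ltn_trans hi)// ltn_exp2r.
Qed.

(** With $d=\gcd(u,b)$, $u=pd$, $b=qd$ and $p,q$ coprime, the equation becomes $pv=q^2d$; hence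
    $p\mid d$, and $g=d/p$ works. For $b=0$ one has $u=0$ instead. *)
Lemma mul_eq_sqr (u v b : nat) : 0 < v -> u * v = b ^ 2 ->
  exists g p q, [/\ u = g * p ^ 2, b = g * (p * q) & v = g * q ^ 2].
Proof.
move=> v0 uvb.
have [b0|b0] := posnP b.
  exists v, 0, 1; rewrite b0 exp0n// exp1n !muln0 muln1; split=> //.
  by move: uvb; rewrite b0 exp0n// => /eqP; rewrite muln_eq0 (gtn_eqF v0) orbF => /eqP.
have u0 : 0 < u.
  case: (posnP u) uvb => // ->; rewrite mul0n => /esym/eqP.
  by rewrite expn_eq0 (gtn_eqF b0).
pose d := gcdn u b; have d0 : 0 < d by rewrite gcdn_gt0 u0.
pose p := u %/ d; pose q := b %/ d.
have up : u = p * d by rewrite divnK// dvdn_gcdl.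
have bq : b = q * d by rewrite divnK// dvdn_gcdr.
have cpq : coprime p q.
  by rewrite /coprime -(eqn_pmul2r d0) muln_gcdl -up -bq mul1n /d.
have p0 : 0 < p by move: u0; rewrite up muln_gt0 => /andP[].
have E : p * v = q ^ 2 * d.
  by apply/eqP; rewrite -(eqn_pmul2r d0) -[eqbRHS]mulnA mulnn
    -expnMn -bq -uvb mulnAC -up.
have pd : p %| d.
  by rewrite -(@Gauss_dvdr p (q ^ 2)) ?coprimeXr// -E dvdn_mulr.
exists (d %/ p), p, q; have {}pd := divnK pd.
split; [by rewrite -mulnn mulnA pd mulnC| by rewrite mulnA pd mulnC|].
by apply/eqP; rewrite -(eqn_pmul2l p0) E -{1}pd; apply/eqP; lia.
Qed.

(** A reduced fraction $t/s$ determines its terms: $s\mid s't$ and coprimality give $s\mid s'$, and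
    symmetrically $s'\mid s$. *)
Lemma coprime_cross_inj (s t s' t' : nat) : 0 < s -> coprime s t ->
  coprime s' t' -> s * t' = s' * t -> s = s' /\ t = t'.
Proof.
move=> s0 c c' E.
have ss' : s = s'.
  apply/eqP; rewrite eqn_dvd -(Gauss_dvdl _ c) -E dvdn_mulr//=.
  by rewrite -(Gauss_dvdl _ c') E dvdn_mulr.
by subst s'; split=> //; move/eqP: E; rewrite eqn_pmul2l// => /eqP.
Qed.

(** Gauss's identity with a summation range that does not depend on $m$, so that double sums over
    $m$ and $d$ can be exchanged. *)
Lemma sum_totient_dvd_le (m M : nat) : 0 < m <= M ->
  \sum_(1 <= d < M.+1 | d %| m) totient d = m.
Proof.
move=> /andP[m0 mM].
rewrite -[RHS]sum_totient_dvd -(big_mkord (fun d => d %| m)).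
rewrite [RHS]big_ltn_cond//= dvd0n (gtn_eqF m0).
rewrite (@big_nat_widen _ _ _ _ m.+1 M.+1)//.
by apply: eq_bigl => i; case: (boolP (i %| m)) => //= /(dvdn_leq m0) im; rewrite ltnS im.
Qed.

Lemma totient_le (n : nat) : totient n <= n.
Proof.
rewrite totient_count_coprime.
apply: (@leq_trans (\sum_(0 <= d < n) 1)); last by rewrite sum_nat_const_nat subn0 muln1.
by apply: leq_sum => i _; case: coprime.
Qed.

Lemma size_coprime_iota (s : nat) : size [seq t <- iota 0 s | coprime s t] = totient s.
Proof.
rewrite size_filter -sum1_count big_mkcond /= totient_count_coprime /index_iota subn0.
by apply: eq_bigr => i _; case: coprime.
Qed.

Lemma count_dvdn_iota (d M : nat) : 0 < d -> count (dvdn d) (iota 1 M) = M %/ d.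
Proof.
move=> d0; elim: M => [|M IH]; first by rewrite div0n.
by rewrite -{1}(addn1 M) iotaD count_cat IH /= addn0 add1n addnC divnS.
Qed.

(** Gauss's identity summed over $m\le M$: after exchanging the sums, $\varphi(d)$ is counted once
    for each of the $\lfloor M/d\rfloor$ multiples of $d$. *)
Lemma sum_totient_floor (M : nat) :
  \sum_(1 <= d < M.+1) totient d * (M %/ d) = \sum_(1 <= m < M.+1) m.
Proof.
rewrite [RHS](eq_big_nat _ _ (F2 := fun m => \sum_(1 <= d < M.+1 | d %| m) totient d)); last first.
  by move=> m Hm; rewrite sum_totient_dvd_le.
rewrite (exchange_big_dep_nat xpredT)//=; apply: eq_big_nat => d /andP[d0 _].
by rewrite big_const_seq iter_addn_0 /index_iota subn1 count_dvdn_iota.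
Qed.

(* In sum_(d <= 3h) phi(d) floor(3h / d) = 3h (3h + 1) / 2, the terms with d <= h
   contribute at most 3h^2 in total, and floor(3h / d) <= 2 for d > h. *)
Lemma sum_totient_interval (h : nat) :
  3 * h ^ 2 <= 4 * \sum_(h.+1 <= d < (3 * h).+1) totient d.
Proof.
have [->|h0] := posnP h; first by [].
have := sum_totient_floor (3 * h).
have -> : \sum_(1 <= m < (3 * h).+1) m = 'C((3 * h).+1, 2).
  by rewrite -bin2_sum [RHS]big_ltn.
rewrite bin2 /= (@big_cat_nat _ _ _ h.+1)//=; last by lia.
have lo : \sum_(1 <= d < h.+1) totient d * (3 * h %/ d) <= 3 * h ^ 2.
  apply: (@leq_trans (\sum_(1 <= d < h.+1) 3 * h)); last first.
    by rewrite sum_nat_const_nat; lia.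
  apply: leq_sum => d _.
  by apply: leq_trans (leq_divM _ d); rewrite mulnC leq_mul2l totient_le orbT.
have hi : \sum_(h.+1 <= d < (3 * h).+1) totient d * (3 * h %/ d)
    <= 2 * \sum_(h.+1 <= d < (3 * h).+1) totient d.
  rewrite big_distrr /= !big_seq; apply: leq_sum => d.
  rewrite mem_index_iota => /andP[hd _]; rewrite mulnC leq_mul2r -ltnS ltn_divLR; lia.
(* Halving may lose one; the linear term $3h$ of $9h^2+3h$ absorbs it since $h\ge1$. *)
have : (3 * h).+1 * (3 * h) <= ((3 * h).+1 * (3 * h))./2.*2.+1 by lia.
move: lo hi; set A := \sum_(_ <= _ < _) _; set B := \sum_(_ <= _ < _) _.
set C := \sum_(_ <= _ < _) _; set X := _./2; nia.
Qed.

Lemma pythagorean_triples_cover (N : nat) : exists L : seq (nat * nat * nat),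
  size L = \sum_(1 <= q < (2 * N).+1) q.+1 * (2 * N %/ q ^ 2) /\
  forall a b c, a ^ 2 + b ^ 2 = c ^ 2 -> 0 < c <= N -> (a, b, c) \in L.
Proof.
pose F q p g := ((g * q ^ 2 - g * p ^ 2) %/ 2, g * (p * q), (g * q ^ 2 + g * p ^ 2) %/ 2).
exists [seq z | q <- iota 1 (2 * N),
  z <- [seq F q p g | p <- iota 0 q.+1, g <- iota 1 (2 * N %/ q ^ 2)]]; split.
  rewrite size_allpairs_dep sumnE big_map /index_iota subn1.
  by apply: eq_bigr => q _; rewrite size_allpairs !size_iota.
move=> a b c E /andP[c0 cN].
have ac : a <= c by rewrite -(@leq_exp2r _ _ 2)// -E leq_addr.
have [||g [p [q [ug bg vg]]]] := @mul_eq_sqr (c - a) (c + a) b; [lia| |].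
  by rewrite -subn_sqr -E addKn.
have q0 : 0 < q by case: (posnP q) vg => // ->; rewrite exp0n// muln0; lia.
have g0 : 0 < g by case: (posnP g) vg => // ->; rewrite mul0n; lia.
have pq : p <= q.
  by rewrite -(@leq_exp2r _ _ 2)// -(leq_pmul2l g0) -ug -vg; lia.
have gq : g * q ^ 2 <= 2 * N by lia.
have q2 : q <= q ^ 2 by rewrite -[leqLHS]muln1 -mulnn leq_mul.
have qN : q <= 2 * N by apply: leq_trans gq; apply: leq_trans q2 _; rewrite leq_pmull.
apply/allpairsPdep; exists q, (a, b, c); split=> //.
  by rewrite mem_iota; lia.
apply/allpairsPdep; exists p, g; split; rewrite ?mem_iota//.
  by rewrite g0 add1n ltnS leq_divRL// expn_gt0 q0.
by rewrite /F -bg -ug -vg; congr (_, _, _); lia.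
Qed.

Lemma uniq_dep_pairs (T1 T2 : eqType) (s : seq T1) (t : T1 -> seq T2) :
  uniq s -> (forall x, uniq (t x)) -> uniq [seq (x, y) | x <- s, y <- t x].
Proof.
move=> us ut; apply: allpairs_uniq_dep => //.
by move=> [x y] [x' y'] _ _ /= [-> ->].
Qed.

Lemma pythagorean_param (g s t : nat) : t <= s ->
  (g * (s ^ 2 - t ^ 2)) ^ 2 + (g * (2 * s * t)) ^ 2 = (g * (s ^ 2 + t ^ 2)) ^ 2.
Proof.
move=> /subnKC <-; set d := s - t.
have -> : (t + d) ^ 2 - t ^ 2 = d * (2 * t + d) by lia.
by lia.
Qed.

(** The scale $g$ runs through $\lfloor K/s^2\rfloor$ consecutive values with $K<gs^2\le2K$, and
    $t<s$ then gives $K<g(s^2+t^2)\le4K$. No triple is repeated: $a$ and $c$ determine $gs^2$ and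
    $gt^2$, hence the reduced fraction $t/s$, hence $g$. *)
Lemma pythagorean_triples_window (K : nat) : exists L : seq (nat * nat * nat),
  [/\ uniq L, size L = \sum_(1 <= s < K.+1) totient s * (K %/ s ^ 2) &
  forall a b c, (a, b, c) \in L ->
    [/\ a ^ 2 + b ^ 2 = c ^ 2 & K < c <= 4 * K]].
Proof.
pose I := [seq (s, x) | s <- iota 1 K,
  x <- [seq (t, g) | t <- [seq t <- iota 0 s | coprime s t],
                     g <- iota (K %/ s ^ 2).+1 (K %/ s ^ 2)]].
pose F (x : nat * (nat * nat)) := let: (s, (t, g)) := x in
  (g * (s ^ 2 - t ^ 2), g * (2 * s * t), g * (s ^ 2 + t ^ 2)).
have inI s t g : (s, (t, g)) \in I ->
    [/\ 0 < s, t < s, coprime s t & K < g * s ^ 2 <= 2 * K].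
  move=> /allpairsPdep[s' [[t' g'] [hs /allpairsPdep[t'' [g'' [ht hg [-> ->]]]] [-> -> ->]]]].
  move: hs ht hg; rewrite mem_filter !mem_iota => hs /andP[cst ht] hg.
  split=> //; [lia..|].
  have s0 : 0 < s' ^ 2 by rewrite expn_gt0; lia.
  rewrite -ltn_divLR//; apply/andP; split; first by lia.
  have := leq_divM K (s' ^ 2); have : g'' <= 2 * (K %/ s' ^ 2) by lia.
  by rewrite -(leq_pmul2r s0); lia.
have uI : uniq I.
  apply: uniq_dep_pairs => [|s]; first exact: iota_uniq.
  by apply: uniq_dep_pairs => [|t]; rewrite ?filter_uniq ?iota_uniq.
exists (map F I); split.
- rewrite map_inj_in_uniq//.
  move=> [s [t g]] [s' [t' g']] /inI[s0 ts cst h] /inI[s'0 ts' cst' h'] [E1 _ E3].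
  have st2 : t ^ 2 <= s ^ 2 by rewrite leq_exp2r// ltnW.
  have st2' : t' ^ 2 <= s' ^ 2 by rewrite leq_exp2r// ltnW.
  have gst2 := leq_mul (leqnn g) st2; have gst2' := leq_mul (leqnn g') st2'.
  rewrite !mulnBr !mulnDr in E1 E3.
  have Es : g * s ^ 2 = g' * s' ^ 2 by lia.
  have Et : g * t ^ 2 = g' * t' ^ 2 by lia.
  have g0 : 0 < g by case: (posnP g) h => // ->; rewrite mul0n ltn0.
  (* Compare $gg'(st')^2=(gs^2)(g't'^2)$ with $gg'(s't)^2$. *)
  have Ec : s * t' = s' * t.
    have g'0 : 0 < g' by case: (posnP g') h' => // ->; rewrite mul0n ltn0.
    apply/eqP; rewrite -(@eqn_exp2r _ _ 2)// !expnMn.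
    rewrite -(eqn_pmul2l (m := g * g')) ?muln_gt0 ?g0//.
    apply/eqP; transitivity ((g * s ^ 2) * (g' * t' ^ 2)); first by lia.
    by rewrite Es -Et; lia.
  have [E5 E6] := coprime_cross_inj s0 cst cst' Ec; subst s' t'.
  congr (_, (_, _)); apply/eqP; rewrite -(eqn_pmul2r (m := s ^ 2)) ?Es//.
  by rewrite expn_gt0 s0.
- rewrite size_map size_allpairs_dep sumnE big_map /index_iota subn1.
  by apply: eq_bigr => s _; rewrite size_allpairs size_coprime_iota size_iota.
- move=> a b c /mapP[[s [t g]] /inI[s0 ts cst h] [-> -> ->]]; split.
    by rewrite pythagorean_param// ltnW.
  have : t ^ 2 <= s ^ 2 by rewrite leq_exp2r// ltnW.
  by move=> /(leq_mul (leqnn g)); rewrite mulnDr; lia.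
Qed.

Lemma double_sub_add (m n : nat) : n <= m ->
  2 * m = (m - n) + (m + n) /\ 2 * n = (m + n) - (m - n).
Proof. lia. Qed.

(** Sum and difference show that $d$ divides $2s^2$ and $2t^2$, whose gcd is 2. *)
Lemma gcd_param_le2 (s t d : nat) : coprime s t -> t <= s ->
  d %| s ^ 2 - t ^ 2 -> d %| s ^ 2 + t ^ 2 -> 0 < d <= 2.
Proof.
move=> cst ts d1 d2.
have t2s2 : t ^ 2 <= s ^ 2 by rewrite leq_exp2r.
have ds : d %| 2 * s ^ 2.
  rewrite (double_sub_add t2s2).1.
  exact: dvdn_add.
have dt : d %| 2 * t ^ 2.
  rewrite (double_sub_add t2s2).2.
  exact: dvdn_sub.
have : d %| 2.
  have /eqP c2 : coprime (s ^ 2) (t ^ 2) by rewrite coprimeXl// coprimeXr.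
  have -> : 2 = gcdn (2 * s ^ 2) (2 * t ^ 2) by rewrite -muln_gcdr c2.
  by rewrite dvdn_gcd ds.
by move=> d2'; rewrite (dvdn_gt0 _ d2')// (dvdn_leq _ d2').
Qed.

(** Euclid's triples for coprime $(s,t)$ are divided by their gcd, which is 1 or 2, so that the
    sizes change by at most a factor 2. *)
Lemma primitive_pythagorean_triples (w : nat) : 0 < w -> exists L : seq (nat * nat * nat),
  [/\ uniq L, 4 * w ^ 2 <= size L &
  forall a b c, (a, b, c) \in L ->
    [/\ a ^ 2 + b ^ 2 = c ^ 2, gcdn (gcdn a b) c = 1, 2 * w ^ 2 <= a &
      c <= 288 * w ^ 2]].
Proof.
move=> w0.
(* Keeping $t<s-w$ and $s>4w$ gives $s^2-t^2=(s-t)(s+t)\ge4w^2$; $s\le12w$ gives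
   $s^2+t^2\le288w^2$. *)
pose I := [seq (s, t) | s <- iota (4 * w).+1 (8 * w),
                        t <- [seq t <- iota 0 (s - w) | coprime s t]].
pose A s t := s ^ 2 - t ^ 2; pose B s t := 2 * s * t; pose C s t := s ^ 2 + t ^ 2.
pose d s t := gcdn (gcdn (A s t) (B s t)) (C s t).
pose F (x : nat * nat) := let: (s, t) := x in
  (A s t %/ d s t, B s t %/ d s t, C s t %/ d s t).
have inI s t : (s, t) \in I ->
    [/\ 4 * w < s <= 12 * w, t + w < s & coprime s t].
  move=> /allpairsPdep[s' [t' [hs ht [-> ->]]]].
  by move: hs ht; rewrite mem_filter !mem_iota => hs /andP[cst ht]; split; lia.
have dA s t : d s t %| A s t by apply: dvdn_trans (dvdn_gcdl _ _) (dvdn_gcdl _ _).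
have dB s t : d s t %| B s t by apply: dvdn_trans (dvdn_gcdl _ _) (dvdn_gcdr _ _).
have dC s t : d s t %| C s t by apply: dvdn_gcdr.
have d12 s t : (s, t) \in I -> 0 < d s t <= 2.
  by move=> /inI[hs ht cst]; apply: (gcd_param_le2 cst) => //; lia.
have uI : uniq I.
  apply: uniq_dep_pairs => [|s]; first exact: iota_uniq.
  by rewrite filter_uniq ?iota_uniq.
(* The ratio (c - a) / (c + a) = t^2 / s^2 determines the coprime pair (s, t). *)
exists (map F I); split.
- rewrite map_inj_in_uniq//.
  move=> [s t] [s' t'] h h'.
  have {d12} [d0 d'0] : 0 < d s t /\ 0 < d s' t'.
    by split; [case/andP: (d12 _ _ h) | case/andP: (d12 _ _ h')].
  move: h h' => /inI[hs ht cst] /inI[hs' ht' cst'] [E1 _ E3].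
  have st2 : t ^ 2 <= s ^ 2 by rewrite leq_exp2r//; lia.
  have st2' : t' ^ 2 <= s' ^ 2 by rewrite leq_exp2r//; lia.
  have EA := divnK (dA s t); have EC := divnK (dC s t).
  have EA' := divnK (dA s' t'); have EC' := divnK (dC s' t').
  rewrite -E1 -E3 in EA' EC'.
  set x := A s t %/ d s t in EA EA'; set z := C s t %/ d s t in EC EC'.
  have Es2 : 2 * s ^ 2 = (x + z) * d s t by rewrite mulnDl EA EC (double_sub_add st2).1.
  have Es2' : 2 * s' ^ 2 = (x + z) * d s' t' by rewrite mulnDl EA' EC' (double_sub_add st2').1.
  have Et2 : 2 * t ^ 2 = z * d s t - x * d s t by rewrite EA EC (double_sub_add st2).2.
  have Et2' : 2 * t' ^ 2 = z * d s' t' - x * d s' t' by rewrite EA' EC' (double_sub_add st2').2.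
  have sw y : d s' t' * (y * d s t) = d s t * (y * d s' t').
    by rewrite mulnCA [RHS]mulnCA (mulnC (d s t)).
  have Es : d s' t' * s ^ 2 = d s t * s' ^ 2.
    by apply/eqP; rewrite -(@eqn_pmul2l 2)// (mulnCA 2 (d s' t')) (mulnCA 2 (d s t)) Es2 Es2' sw.
  have Et : d s' t' * t ^ 2 = d s t * t' ^ 2.
    apply/eqP; rewrite -(@eqn_pmul2l 2)// (mulnCA 2 (d s' t')) (mulnCA 2 (d s t)) Et2 Et2' !mulnBr.
    by rewrite !sw.
  have Ec : s * t' = s' * t.
    apply/eqP; rewrite -(@eqn_exp2r _ _ 2)// !expnMn.
    rewrite -(eqn_pmul2l (m := d s t * d s' t')) ?muln_gt0 ?d0//.
    apply/eqP; transitivity ((d s' t' * s ^ 2) * (d s t * t' ^ 2)); first by lia.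
    by rewrite Es -Et; lia.
  have s0 : 0 < s by case/andP: hs => /(leq_ltn_trans (leq0n _)).
  by have [-> ->] := coprime_cross_inj s0 cst cst' Ec.
- rewrite size_map size_allpairs_dep sumnE big_map.
  (* The totients over $4w<s\le12w$ sum to at least $12w^2$. Discarding $t\ge s-w$ costs at most $w$
     for each of the $8w$ values of $s$, so $4w^2$ pairs remain. *)
  have := sum_totient_interval (4 * w).
  rewrite /index_iota (_ : (3 * (4 * w)).+1 - (4 * w).+1 = 8 * w); last by lia.
  have : \sum_(i <- iota (4 * w).+1 (8 * w)) totient i <=
     \sum_(i <- iota (4 * w).+1 (8 * w)) (size [seq t <- iota 0 (i - w) | coprime i t] + w).
    rewrite !big_seq; apply: leq_sum => s; rewrite mem_iota => /andP[hs _].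
    rewrite -size_coprime_iota.
    have -> : iota 0 s = iota 0 (s - w) ++ iota (s - w) w.
      by rewrite -[s - w in RHS]add0n -iotaD subnK//; lia.
    rewrite filter_cat size_cat leq_add2l size_filter.
    by apply: leq_trans (count_size _ _) _; rewrite size_iota.
  rewrite big_split /= [X in _ + X]big_const_seq count_predT size_iota iter_addn_0.
  set X := \sum_(_ <- _) _; set Y := \sum_(_ <- _) _.
  by move=> h1 h2; lia.
- move=> a b c /mapP[[s t] /[dup] /d12 /andP[d0 d2] /inI[hs ht cst] [-> -> ->]].
  have EA := divnK (dA s t); have EB := divnK (dB s t); have EC := divnK (dC s t).
  split.
  + apply/eqP; rewrite -(@eqn_pmul2r (d s t ^ 2)) ?expn_gt0 ?d0// mulnDl -!expnMn.
    rewrite EA EB EC; apply/eqP.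
    by have := @pythagorean_param 1 s t; rewrite !mul1n; apply; lia.
  + apply/eqP; rewrite -(@eqn_pmul2r (d s t))// !muln_gcdl EA EB EC mul1n.
    by rewrite /d.
  + rewrite leq_divRL//; apply: leq_trans (_ : 4 * w ^ 2 <= _); first by nia.
    rewrite /A subn_sqr (_ : 4 * w ^ 2 = w * (4 * w)); last by rewrite mulnCA.
    by apply: leq_mul; lia.
  + apply: leq_trans (leq_div _ _) _; rewrite /C.
    have : s ^ 2 <= (12 * w) ^ 2 by rewrite leq_exp2r//; lia.
    have : t ^ 2 <= (12 * w) ^ 2 by rewrite leq_exp2r//; lia.
    by lia.
Qed.

Local Open Scope classical_set_scope.
Local Open Scope ring_scope.

(** * Harmonic and totient sums *)

Lemma ln_le_harmonic (R : realType) (M : nat) :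
  ln M.+1%:R <= \sum_(1 <= m < M.+1) m%:R^-1 :> R.
Proof.
elim: M => [|M IH]; first by rewrite ln1 big_geq.
rewrite big_nat_recr//=.
have M0 : 0 < M.+1%:R :> R by rewrite ltr0n.
have -> : M.+2%:R = M.+1%:R * (1 + M.+1%:R^-1) :> R.
  by rewrite mulrDr mulr1 mulfV ?gt_eqF// -natr1.
rewrite lnM ?posrE ?addr_gt0 ?invr_gt0//.
apply: lerD => //; apply: le_ln1Dx.
by apply: lt_trans (_ : 0 < _); rewrite ?ltrN10 ?invr_gt0.
Qed.

Lemma harmonic_le_ln (R : realType) (M : nat) :
  \sum_(1 <= m < M.+2) m%:R^-1 <= 1 + ln M.+1%:R :> R.
Proof.
elim: M => [|M IH]; first by rewrite ln1 big_nat1 invr1 addr0.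
rewrite big_nat_recr//=.
have M0 : 0 < M.+1%:R :> R by rewrite ltr0n.
have M1 : 0 < M.+2%:R :> R by rewrite ltr0n.
have E : M.+1%:R = M.+2%:R * (1 - M.+2%:R^-1) :> R.
  by rewrite mulrBr mulr1 mulfV ?gt_eqF// -[M.+2%:R]natr1 addrK.
have D0 : 0 < 1 - M.+2%:R^-1 :> R by rewrite subr_gt0 invf_lt1// ltr1n.
rewrite -lerBrDr; apply: le_trans IH _; rewrite E lnM// -addrA lerD2l lerD2l.
by apply: le_ln1Dx; rewrite ltrN2 invf_lt1// ltr1n.
Qed.

Lemma sum_inv_sqr_le2 (R : realType) (M : nat) :
  \sum_(1 <= e < M.+1) (e%:R ^+ 2)^-1 <= 2 :> R.
Proof.
case: M => [|M]; first by rewrite big_geq.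
(* The subtracted term makes the induction work, by telescoping $1/e^2\le1/(e-1)-1/e$. *)
suff : \sum_(1 <= e < M.+2) (e%:R ^+ 2)^-1 <= 2 - M.+1%:R^-1 :> R.
  by move/le_trans; apply; rewrite gerBl invr_ge0.
elim: M => [|M IH]; first by rewrite big_nat1 expr1n invr1; lra.
rewrite big_nat_recr//=.
have M0 : 0 < M.+1%:R :> R by rewrite ltr0n.
have M1 : 0 < M.+2%:R :> R by rewrite ltr0n.
have : (M.+2%:R ^+ 2)^-1 <= M.+1%:R^-1 - M.+2%:R^-1 :> R.
  have -> : M.+1%:R^-1 - M.+2%:R^-1 = (M.+1%:R * M.+2%:R)^-1 :> R.
    rewrite -[M.+2%:R]natr1 in M1 *; move: M0 M1; set x := M.+1%:R => x0 x1.
    by field; rewrite !gt_eqF.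
  by rewrite lef_pV2 ?posrE ?mulr_gt0// ?exprn_gt0// expr2 ler_pM2r// ler_nat.
by move/(lerD IH)/le_trans; apply; rewrite subrKA.
Qed.

(** Writing $m=de$ factors out $1/d^2$, and the sum of $1/e^2$ is at most 2. *)
Lemma sum_dvdn_inv_sqr (R : realType) (d M : nat) : (0 < d)%N ->
  \sum_(1 <= m < M.+1 | (d %| m)%N) (m%:R ^+ 2)^-1 <= 2 * (d%:R ^+ 2)^-1 :> R.
Proof.
move=> d0; apply: (@le_trans _ _ (\sum_(1 <= e < M.+1) (d%:R ^+ 2)^-1 * (e%:R ^+ 2)^-1)).
  rewrite [leRHS](eq_big_nat _ _ (F2 := fun e => ((d * e)%:R ^+ 2)^-1)); last first.
    by move=> e _; rewrite natrM exprMn [RHS]invfM.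
  (* Induction on $M$: a new term appears exactly when $\lfloor M/d\rfloor$ increases. *)
  have -> : \sum_(1 <= m < M.+1 | (d %| m)%N) (m%:R ^+ 2)^-1 =
      \sum_(1 <= e < (M %/ d).+1) ((d * e)%:R ^+ 2)^-1 :> R.
    elim: M => [|M IH]; first by rewrite div0n !big_geq.
    rewrite [LHS]big_mkcond/= big_nat_recr//= -big_mkcond/= IH divnS//.
    case: (boolP (d %| M.+1)%N) => /= [h|_]; last by rewrite add0n addr0.
    rewrite add1n [RHS]big_nat_recr//=; congr (_ + (_ ^+ 2)^-1).
    have -> : ((M %/ d).+1 = M.+1 %/ d)%N by rewrite divnS// h.
    by rewrite mulnC divnK.
  rewrite [leRHS](@big_cat_nat _ _ _ (M %/ d).+1)//=; last by rewrite ltnS leq_div.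
  by rewrite lerDl sumr_ge0// => e _; rewrite invr_ge0 exprn_ge0.
by rewrite -mulr_sumr mulrC ler_wpM2r ?invr_ge0 ?exprn_ge0// sum_inv_sqr_le2.
Qed.

(** Write $1/m=m/m^2=\sum_{d\mid m}\varphi(d)/m^2$ and sum over the multiples $m$ of each $d$
    first. *)
Lemma sum_totient_inv_sqr (R : realType) (M : nat) :
  \sum_(1 <= m < M.+1) m%:R^-1 <=
  2 * \sum_(1 <= d < M.+1) (totient d)%:R * (d%:R ^+ 2)^-1 :> R.
Proof.
rewrite [leLHS](eq_big_nat _ _ (F2 := fun m =>
  \sum_(1 <= d < M.+1 | (d %| m)%N) (totient d)%:R * (m%:R ^+ 2)^-1)); last first.
  move=> m mM; rewrite -mulr_suml -natr_sum sum_totient_dvd_le//.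
  by case/andP: mM => m0 _; rewrite expr2 invfM mulrA mulfV ?mul1r// pnatr_eq0 -lt0n.
rewrite (exchange_big_dep_nat xpredT)//= mulr_sumr.
rewrite !big_seq; apply: ler_sum => d; rewrite mem_index_iota => /andP[d0 _].
by rewrite -mulr_sumr mulrCA ler_wpM2l// sum_dvdn_inv_sqr.
Qed.

Lemma natr_divn_le (R : realType) (m d : nat) : (m %/ d)%:R <= m%:R / d%:R :> R.
Proof.
have [->|d0] := posnP d; first by rewrite divn0 invr0 mulr0.
by rewrite ler_pdivlMr ?ltr0n// -natrM ler_nat leq_divM.
Qed.

(** The remainder is below $d\le d\lfloor m/d\rfloor$, so rounding down at most halves the
    quotient. *)
Lemma natr_divn_ge (R : realType) (m d : nat) : (0 < d <= m)%N ->
  m%:R / d%:R <= 2 * (m %/ d)%:R :> R.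
Proof.
move=> /andP[d0 dm]; rewrite ler_pdivrMr ?ltr0n// -!natrM ler_nat.
have q0 : (0 < m %/ d)%N by rewrite divn_gt0.
rewrite {1}(divn_eq m d) -mulnA mul2n -addnn leq_add2l.
by rewrite (leq_trans (ltnW (ltn_pmod _ d0)))// leq_pmull.
Qed.

(** Only $s\le M=\lfloor\sqrt K\rfloor$ are kept, where $K/s^2\ge1$. The constant 8 collects three
    factors 2: from $\ln K\le2\ln(M+1)$, from the totient sum and from rounding down. *)
Lemma sum_totient_floor_sqr_ge (R : realType) (K : nat) : (0 < K)%N ->
  K%:R * ln K%:R <= 8 * (\sum_(1 <= s < K.+1) totient s * (K %/ s ^ 2))%:R :> R.
Proof.
move=> K0; have [M /andP[MK KM]] := nat_sqrt K.
have M0 : (0 < M)%N by case: (posnP M) KM => // ->; rewrite exp1n ltnS leqNgt K0.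
have MleK : (M <= K)%N by apply: leq_trans MK; rewrite -[leqLHS]expn1 leq_pexp2l.
have lnK : ln K%:R <= 2 * \sum_(1 <= m < M.+1) m%:R^-1 :> R.
  apply: le_trans (_ : 2 * ln M.+1%:R <= _); last by rewrite ler_wpM2l// ln_le_harmonic.
  rewrite mulr_natl -lnXn// ler_ln ?posrE ?ltr0n// ?exprn_gt0//.
  by rewrite -natrX ler_nat ltnW.
have tot := sum_totient_inv_sqr R M.
have low : K%:R * (\sum_(1 <= d < M.+1) (totient d)%:R * (d%:R ^+ 2)^-1) <=
    2 * (\sum_(1 <= s < K.+1) totient s * (K %/ s ^ 2))%:R :> R.
  rewrite (@big_cat_nat _ _ _ M.+1 1 K.+1)//= natrD mulrDr.
  apply: (@le_trans _ _ (2 * (\sum_(1 <= s < M.+1) totient s * (K %/ s ^ 2))%:R)); last first.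
    by rewrite lerDl mulr_ge0.
  rewrite natr_sum !mulr_sumr !big_seq; apply: ler_sum => s.
  rewrite mem_index_iota ltnS => /andP[s0 sM].
  rewrite natrM mulrCA [leRHS]mulrCA ler_wpM2l// -natrX natr_divn_ge//.
  by rewrite expn_gt0 s0 (leq_trans _ MK)// leq_exp2r.
move: (ler_wpM2l (ler0n R K) lnK) (ler_wpM2l (ler0n R K) tot) low.
by set X := \sum_(_ <= _ < _) _; set Y := \sum_(_ <= _ < _) _; lra.
Qed.

(** Each term is at most $2q\cdot2N/q^2=4N/q$, which leaves a harmonic sum. *)
Lemma sum_floor_sqr_le (R : realType) (N : nat) : (0 < N)%N ->
  (\sum_(1 <= q < (2 * N).+1) q.+1 * (2 * N %/ q ^ 2))%:R
  <= 4 * N%:R * (1 + ln (2 * N)%:R) :> R.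
Proof.
move=> N0; have [m mE] : exists m, (2 * N = m.+1)%N by exists (2 * N).-1; lia.
apply: (@le_trans _ _ (4 * N%:R * \sum_(1 <= q < (2 * N).+1) q%:R^-1)); last first.
  by rewrite ler_wpM2l ?mulr_ge0// mE harmonic_le_ln.
rewrite natr_sum mulr_sumr !big_seq; apply: ler_sum => q.
rewrite mem_index_iota => /andP[q0 _]; rewrite natrM.
have q0' : 0 < q%:R :> R by rewrite ltr0n.
apply: (@le_trans _ _ (2 * q%:R * ((2 * N)%:R / (q ^ 2)%:R))).
  apply: ler_pM => //; last exact: natr_divn_le.
  by rewrite -natrM ler_nat mul2n -addnn -addn1 leq_add2l.
by rewrite natrX natrM le_eqVlt; apply/orP; left; apply/eqP; field; rewrite gt_eqF.
Qed.

(** * Tangency of lattice circles *)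

(** The list may have repetitions. It also makes [A] finite, so that [card_set] is not a default
    value. *)
Lemma card_set_le (T : choiceType) (A : set T) (L : seq T) :
  (forall x, A x -> x \in L) -> (card_set A <= size L)%N.
Proof.
move=> AL; apply: uniq_leq_size; first exact: fset_uniq.
have fA : finite_set A.
  by apply: sub_finite_set (finite_seq L) => x /AL.
by move=> x; rewrite in_fset_set// inE => /AL.
Qed.

Lemma card_set_ge (T : choiceType) (A : set T) (L : seq T) :
  finite_set A -> uniq L -> (forall x, x \in L -> A x) -> (size L <= card_set A)%N.
Proof.
move=> fA uL LA; apply: uniq_leq_size => // x /LA Ax.
by rewrite in_fset_set// inE.
Qed.

Lemma card_set_mono (T : choiceType) (A B : set T) :
  finite_set B -> A `<=` B -> (card_set A <= card_set B)%N.
Proof.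
move=> fB AB; apply: fsubset_leq_card; rewrite -fset_set_sub//.
exact: sub_finite_set fB.
Qed.

Lemma finite_subsets (T : choiceType) (A : set T) :
  finite_set A -> finite_set [set S | S `<=` A].
Proof.
move=> fA; pose f (X : {fset T}) : set T := [set` X].
apply: (@sub_finite_set _ _ (f @` [set` fpowerset (fset_set A)])); last first.
  exact: finite_image.
move=> S /= SA; have fS : finite_set S by apply: sub_finite_set SA fA.
exists (fset_set S); last by rewrite /f fset_setK.
by rewrite /= fpowersetE -fset_set_sub.
Qed.

Lemma card_set2 (T : choiceType) (x y : T) : x != y -> card_set [set x; y] = 2%N.
Proof.
move=> xy; rewrite /card_set fset_setU// !fset_set1 cardfs2.
by rewrite xy.
Qed.

(** Meant for three pairwise tangent circles: their index differences are all null for the Lorentz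
    form. Polarization makes two of them orthogonal, which puts the three circles on one light
    ray. *)
Lemma null_vectors_parallel (a b c x y z : int) :
  a ^+ 2 + b ^+ 2 = c ^+ 2 -> x ^+ 2 + y ^+ 2 = z ^+ 2 ->
  (x - a) ^+ 2 + (y - b) ^+ 2 = (z - c) ^+ 2 -> x * c = z * a /\ y * c = z * b.
Proof.
move=> abc xyz diff.
have dot : x * a + y * b = z * c.
  apply: (@mulfI _ 2) => //.
  transitivity (x ^+ 2 + y ^+ 2 + (a ^+ 2 + b ^+ 2) - ((x - a) ^+ 2 + (y - b) ^+ 2)).
    by ring.
  by rewrite abc xyz diff; ring.
(* Two null vectors that are orthogonal for the Lorentz form are parallel. *)
have : (x * c - z * a) ^+ 2 + (y * c - z * b) ^+ 2 = 0.
  transitivity (c ^+ 2 * (x ^+ 2 + y ^+ 2) - 2 * (z * c) * (x * a + y * b)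
    + z ^+ 2 * (a ^+ 2 + b ^+ 2)); first by ring.
  by rewrite abc xyz dot; ring.
move/eqP; rewrite paddr_eq0 ?sqr_ge0// !sqrf_eq0 !subr_eq0.
by move=> /andP[/eqP -> /eqP ->].
Qed.

(** $c$ divides $za$ and $zb$, hence $z\gcd(a,b)$, and it is coprime to $\gcd(a,b)$; so $m=z/c$ is
    an integer. *)
Lemma primitive_multiple (a b c : nat) (x y z : int) :
  (0 < c)%N -> gcdn (gcdn a b) c = 1%N -> x * c%:Z = z * a%:Z -> y * c%:Z = z * b%:Z ->
  exists m : int, [/\ x = m * a%:Z, y = m * b%:Z & z = m * c%:Z].
Proof.
move=> c0 g1 xc yc.
have ca : (c %| `|z| * a)%N.
  by rewrite -[a]/(`|a%:Z|%N) -abszM -xc abszM dvdn_mull.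
have cb : (c %| `|z| * b)%N.
  by rewrite -[b]/(`|b%:Z|%N) -abszM -yc abszM dvdn_mull.
have : (c %| `|z|)%N.
  rewrite -(@Gauss_dvdl _ _ (gcdn a b)) ?muln_gcdr ?dvdn_gcd ?ca//.
  by rewrite /coprime gcdnC g1.
move=> cz; have /dvdzP[m zm] : (c%:Z %| z)%Z by [].
have c0' : c%:Z != 0 by rewrite eqz_nat -lt0n.
exists m; split=> //; apply: (mulIf c0').
  by rewrite xc zm mulrAC.
by rewrite yc zm mulrAC.
Qed.

(** A step $m\le-1$ would give $j'\le j-a\le0$, and $m\ge2$ would give $l'\ge l+2c>N$. *)
Lemma step_in_window (a c j j' l l' N : nat) (m : int) :
  (j <= a)%N -> (0 < j')%N -> (l' <= N)%N -> (N < l + 2 * c)%N ->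
  j'%:Z - j%:Z = m * a%:Z -> l'%:Z - l%:Z = m * c%:Z -> m = 0 \/ m = 1.
Proof.
move=> ja j'0 l'N Nlc ma mc.
have [m1|m0] := leP m (-1).
  have : m * a%:Z <= (-1) * a%:Z by apply: ler_wpM2r.
  by move: ma; set x := m * _; clear mc; lia.
have [m2|m2] := leP 2 m; last by lia.
have : 2 * c%:Z <= m * c%:Z by apply: ler_wpM2r.
by move: mc; set x := m * _; clear ma; lia.
Qed.

Lemma euclid_distC (R : realType) (P Q : plane R) : euclid_dist P Q = euclid_dist Q P.
Proof. by congr (Num.sqrt (_ + _)); rewrite -sqrrN opprB. Qed.

Lemma tangent_sym (R : realType) (C C' : circle R) : tangent C C' -> tangent C' C.
Proof. by case=> ne E; split; [exact: nesym | rewrite euclid_distC distrC]. Qed.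

Definition lattice_circle (R : realType) (delta : R) (j k l : int) : circle R :=
  mk_circle (j%:~R * delta) (k%:~R * delta) (l%:~R * delta).

Lemma lattice_circle_inj (R : realType) (delta : R) (j k l j' k' l' : int) :
  0 < delta ->
  lattice_circle delta j k l = lattice_circle delta j' k' l' ->
  [/\ j = j', k = k' & l = l'].
Proof.
move=> /lt0r_neq0 d0.
by case=> /(mulIf d0)/eqP + /(mulIf d0)/eqP + /(mulIf d0)/eqP;
  rewrite !eqr_int => /eqP -> /eqP -> /eqP ->.
Qed.

(** The scale $\delta$ cancels after squaring. Distinctness reduces to $l\ne l'$, because $l=l'$
    makes the sum of two squares vanish. *)
Lemma tangent_lattice_circle (R : realType) (delta : R) (j k l j' k' l' : int) :
  0 < delta ->
  tangent (lattice_circle delta j k l) (lattice_circle delta j' k' l') <->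
  l != l' /\ (j - j') ^+ 2 + (k - k') ^+ 2 = (l - l') ^+ 2.
Proof.
move=> delta_gt0; have intr2 (x : int) : (x ^+ 2)%:~R = x%:~R ^+ 2 :> R by rewrite rmorphXn.
have E : (euclid_dist (j%:~R * delta, k%:~R * delta) (j'%:~R * delta, k'%:~R * delta)
     = `|l%:~R * delta - l'%:~R * delta|) <->
     (j - j') ^+ 2 + (k - k') ^+ 2 = (l - l') ^+ 2.
  rewrite /euclid_dist /= -!mulrBl -!intrB !exprMn -mulrDl -!intr2 -intrD.
  have -> : `|(l - l')%:~R * delta| = Num.sqrt (((l - l') ^+ 2)%:~R * delta ^+ 2).
    by rewrite intr2 -exprMn sqrtr_sqr.
  have d2 : delta ^+ 2 != 0 by rewrite expf_neq0// gt_eqF.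
  split=> [|->//].
  move/eqP; rewrite eqr_sqrt; [|by apply: mulr_ge0; rewrite ?ler0z ?addr_ge0 ?sqr_ge0..].
  by move/eqP/(mulIf d2)/eqP; rewrite eqr_int => /eqP.
split=> [[ne /E eq]|[ll' /E eq]]; split=> //.
  apply: contra_notN ne => /eqP ll'; move: eq; rewrite ll' subrr expr0n/= => /eqP.
  rewrite paddr_eq0 ?sqr_ge0// !sqrf_eq0 !subr_eq0 => /andP[/eqP -> /eqP ->].
  by [].
by move=> /(lattice_circle_inj delta_gt0)[_ _ /eqP]; rewrite (negPf ll').
Qed.

(** For tangent circles both summands of the distance equal the difference of the radii. *)
Lemma circle_dist_lattice (R : realType) (delta : R) (j k l j' k' l' : int) :
  0 < delta ->
  tangent (lattice_circle delta j k l) (lattice_circle delta j' k' l') ->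
  circle_dist (lattice_circle delta j k l) (lattice_circle delta j' k' l') =
    2 * `|l - l'|%:~R * delta.
Proof.
move=> delta_gt0 [_ E]; rewrite /circle_dist E /= -mulrBl -intrB normrM intr_norm.
by rewrite (gtr0_norm delta_gt0); ring.
Qed.

(** Natural-number indices of the family for $N=\lfloor1/\delta\rfloor$; $N\le2\ell$ expresses
    $N/2\le\ell$ without division. *)
Definition grid (N : nat) : set (nat * nat * nat) :=
  [set x | [&& 0 < x.1.1 <= N, 0 < x.1.2 <= N, N <= 2 * x.2 & x.2 <= N]%N].

Lemma circle_familyP (R : realType) (delta : R) (N : nat) (C : circle R) :
  Num.floor delta^-1 = N%:Z ->
  circle_family delta C <->
  exists j k l : nat, grid N (j, k, l) /\ C = lattice_circle delta j k l.
Proof.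
move=> floor_N; rewrite /circle_family /grid /=; split.
  move=> [j [k [l []]]]; rewrite floor_N => /andP[j1 jN] /andP[k1 kN] /andP[].
  rewrite ler_pdivrMr ?ltr0n// -[2]/(2%:~R) -intrM !ler_int => Nl lN ->.
  case: j k l j1 jN k1 kN Nl lN => [j|//] [k|//] [l|l] j1 jN k1 kN Nl lN; last by lia.
  by exists j, k, l; split=> //; lia.
move=> [j [k [l [/and4P[hj hk Nl lN] ->]]]].
exists j, k, l; rewrite floor_N; split=> //.
rewrite ler_pdivrMr ?ltr0n// -[2]/(2%:~R) -intrM !ler_int.
by lia.
Qed.

Lemma grid_circle (R : realType) (delta : R) (N j k l : nat) :
  0 < delta -> Num.floor delta^-1 = N%:Z ->
  circle_family delta (lattice_circle delta j k l) <->
  grid N (j, k, l).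
Proof.
move=> delta_gt0 floor_N; rewrite (circle_familyP _ floor_N).
split=> [[j' [k' [l' [h]]]]|h]; last by exists j, k, l.
by move/(lattice_circle_inj delta_gt0) => [[->] [->] [->]].
Qed.

(** For maximality, a third circle tangent to both differs from the first by an integer multiple
    $m(a,b,c)$, as the triple is primitive. The bounds $j\le a$ and $N<l+2c$ leave only $m=0,1$, the
    two given circles. *)
Lemma pair_fold_point (R : realType) (delta : R) (N a b c j k l : nat) :
  0 < delta -> Num.floor delta^-1 = N%:Z ->
  (a ^ 2 + b ^ 2 = c ^ 2)%N -> gcdn (gcdn a b) c = 1%N -> (0 < c)%N ->
  (0 < j <= a)%N -> (j + a <= N)%N -> (0 < k)%N -> (k + b <= N)%N ->
  (N <= 2 * l)%N -> (l + c <= N < l + 2 * c)%N ->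
  fold_point (circle_family delta) 1
    [set lattice_circle delta j k l; lattice_circle delta (j + a)%N (k + b)%N (l + c)%N].
Proof.
move=> delta_gt0 floor_N pyth g1 c0 /andP[j0 ja] jaN k0 kbN Nl /andP[lcN Nlc].
have pythZ : a%:Z ^+ 2 + b%:Z ^+ 2 = c%:Z ^+ 2 by lia.
set C := lattice_circle _ _ _ _; set C' := lattice_circle _ _ _ _.
have tg : tangent C C'.
  apply/(tangent_lattice_circle _ _ _ _ _ _ delta_gt0); split; first by lia.
  have sub (u v : nat) : u%:Z - (u + v)%N%:Z = - v%:Z by lia.
  by rewrite !sub !sqrrN; lia.
have tg' := tangent_sym tg.
have FC : circle_family delta C.
  by apply/(grid_circle _ _ _ delta_gt0 floor_N); rewrite /grid/=; lia.
have FC' : circle_family delta C'.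
  by apply/(grid_circle _ _ _ delta_gt0 floor_N); rewrite /grid/=; lia.
have cneq : C != C' by apply/eqP; case: tg.
split.
- by move=> x [->|->].
- have c0' : c%:R != 0 :> R by rewrite pnatr_eq0 -lt0n.
  (* The point of radius 0 on the light ray through both circles: center minus
     radius times the unit vector (a / c, b / c). *)
  pose P : plane R :=
    ((j%:R - l%:R * (a%:R / c%:R)) * delta, (k%:R - l%:R * (b%:R / c%:R)) * delta).
  exists P.
  have unit : (a%:R / c%:R) ^+ 2 + (b%:R / c%:R) ^+ 2 = 1 :> R.
    rewrite !expr_div_n -mulrDl -!natrX -natrD pyth divff// pnatr_eq0.
    by rewrite expn_eq0 negb_and -lt0n c0.
  have on (m : R) : 0 <= m ->
     Num.sqrt ((m * (a%:R / c%:R) * delta) ^+ 2 + (m * (b%:R / c%:R) * delta) ^+ 2) = m * delta.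
    move=> m0; have -> : (m * (a%:R / c%:R) * delta) ^+ 2 + (m * (b%:R / c%:R) * delta) ^+ 2
        = (m * delta) ^+ 2 * ((a%:R / c%:R) ^+ 2 + (b%:R / c%:R) ^+ 2) by ring.
    rewrite unit mulr1 sqrtr_sqr ger0_norm//.
    by rewrite mulr_ge0// ltW.
  have onC : on_circle P C.
    rewrite /on_circle /euclid_dist /= -(on l%:R)//; congr Num.sqrt.
    by rewrite -!pmulrn; ring.
  have onC' : on_circle P C'.
    rewrite /on_circle /euclid_dist /= -!pmulrn -(on (l + c)%:R)//; congr Num.sqrt.
    by rewrite !natrD; field.
  by move=> x y [->|->] [->|->].
- move=> S' sub S'F [P tS']; apply/seteqP; split=> // x S'x.
  have [//|xC] := eqVneq x C; first by left.
  have [//|xC'] := eqVneq x C'; first by right.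
  exfalso.
  have SC : S' C by apply: sub; left.
  have SC' : S' C' by apply: sub; right.
  have [+ _ _] := tS' x C S'x SC (elimN eqP xC).
  have [+ _ _] := tS' x C' S'x SC' (elimN eqP xC').
  have /(circle_familyP _ floor_N)[j' [k' [l' [hx xE]]]] := S'F _ S'x.
  rewrite xE => /(tangent_lattice_circle _ _ _ _ _ _ delta_gt0)[_ e'].
  move=> /(tangent_lattice_circle _ _ _ _ _ _ delta_gt0)[_ e].
  (* If $(x,y,z)$ is the index difference of the third circle and [C], tangency to [C'] says that
     $(x-a,y-b,z-c)$ is null. *)
  have [|xc yc] := null_vectors_parallel pythZ e.
    by rewrite -!addrA -!opprD -!PoszD.
  have [m [ma mb mc]] := primitive_multiple c0 g1 xc yc.
  move: hx; rewrite /grid /= => /and4P[/andP[j'0 j'N] _ _ l'N].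
  have m0 : m != 0.
    apply: contraNneq xC => m0; apply/eqP; rewrite xE /C.
    have sol (u v w : int) : u - v = m * w -> u = v.
      by rewrite m0 mul0r => /eqP; rewrite subr_eq0 => /eqP.
    by congr lattice_circle; [exact: sol ma|exact: sol mb|exact: sol mc].
  have m1 : m != 1.
    apply: contraNneq xC' => m1; apply/eqP; rewrite xE /C' !PoszD.
    have sol (u v w : int) : u - v = m * w -> u = v + w.
      by rewrite m1 mul1r => <-; rewrite addrC subrK.
    by congr lattice_circle; [exact: sol ma|exact: sol mb|exact: sol mc].
  case: (step_in_window ja j'0 l'N Nlc ma mc) => [/eqP|/eqP].
    by rewrite (negPf m0).
  by rewrite (negPf m1).
- by rewrite card_set2.
- by rewrite card_set2.
Qed.

Lemma pair_set_eq (T : choiceType) (x y x' y' : T) : [set x; y] = [set x'; y'] ->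
  (x = x' /\ y = y') \/ (x = y' /\ y = x').
Proof.
move=> E.
have : [set x; y] x by left.
have : [set x; y] y by right.
have : [set x; y] x' by rewrite E; left.
have : [set x; y] y' by rewrite E; right.
rewrite {3 4}E /=.
by do 4 case => ?; subst; auto.
Qed.

(** * Counting circles, pairs and points *)

Definition box (A B C : seq nat) : seq (nat * nat * nat) :=
  [seq (jk, l) | jk <- [seq (j, k) | j <- A, k <- B], l <- C].

Lemma size_box (A B C : seq nat) : size (box A B C) = (size A * size B * size C)%N.
Proof. by rewrite !size_allpairs. Qed.

Lemma uniq_box (A B C : seq nat) : uniq A -> uniq B -> uniq C -> uniq (box A B C).
Proof. by move=> uA uB uC; rewrite !allpairs_uniq// => -[x y] [x' y'] _ _ [-> ->]. Qed.

Lemma mem_box (A B C : seq nat) (j k l : nat) :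
  ((j, k, l) \in box A B C) = [&& j \in A, k \in B & l \in C].
Proof.
apply/allpairsP/and3P => [[[[j' k'] l'] [/= /allpairsP[[? ?] [/= ? ? [-> ->]] ? [-> -> ->]]]]|].
  by [].
move=> [hj hk hl]; exists ((j, k), l); split=> //=.
by apply/allpairsP; exists (j, k).
Qed.

Definition nat_circle (R : realType) (delta : R) (x : nat * nat * nat) : circle R :=
  lattice_circle delta x.1.1 x.1.2 x.2.

Lemma nat_circle_inj (R : realType) (delta : R) : 0 < delta -> injective (nat_circle delta).
Proof.
move=> delta_gt0.
move=> [[j k] l] [[j' k'] l'] /(lattice_circle_inj delta_gt0)[].
by move=> [->] [->] [->].
Qed.

Lemma size_cube (N : nat) : size (box (iota 1 N) (iota 1 N) (iota 1 N)) = (N ^ 3)%N.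
Proof. by rewrite size_box !size_iota !expnS muln1 mulnA. Qed.

Lemma grid_cube (N : nat) (x : nat * nat * nat) : grid N x ->
  x \in box (iota 1 N) (iota 1 N) (iota 1 N).
Proof.
by case: x => [[j k] l]; rewrite /grid/= mem_box !mem_iota; lia.
Qed.

Lemma circle_family_card_le (R : realType) (delta : R) (N : nat) :
  Num.floor delta^-1 = N%:Z -> (card_set (circle_family delta) <= N ^ 3)%N.
Proof.
move=> floor_N; rewrite -size_cube -(size_map (nat_circle delta)).
apply: card_set_le => x.
move=> /(circle_familyP _ floor_N)[j [k [l [h ->]]]].
by apply/mapP; exists (j, k, l) => //; exact: grid_cube.
Qed.

(** A box of side $Q$ lies in the index set: [uphalf N] is the least admissible $\ell$, and $4Q\le
    N$ keeps the radii below the upper end. *)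
Lemma circle_family_card_ge (R : realType) (delta : R) (N Q : nat) :
  0 < delta -> Num.floor delta^-1 = N%:Z ->
  (4 * Q <= N)%N -> (Q ^ 3 <= card_set (circle_family delta))%N.
Proof.
move=> delta_gt0 floor_N QN.
have -> : (Q ^ 3)%N = size (map (nat_circle delta) (box (iota 1 Q) (iota 1 Q) (iota (uphalf N) Q))).
  by rewrite size_map size_box !size_iota !expnS muln1 mulnA.
apply: card_set_ge.
- exact: finite_circle_family.
- by rewrite (map_inj_uniq (nat_circle_inj delta_gt0)) uniq_box ?iota_uniq.
- move=> _ /mapP[[[j k] l] h ->]; apply/(grid_circle _ _ _ delta_gt0 floor_N).
  by move: h; rewrite mem_box !mem_iota /grid/=; lia.
Qed.

(** The listed Pythagorean triples are nonnegative, so a difference of indices is stored as a sign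
    and an absolute value. *)
Definition signed (e : bool) (a : nat) : int := if e then a%:Z else - a%:Z.

Definition shifted_circle (R : realType) (delta : R) (x : nat * nat * nat)
    (v : bool * bool * bool * (nat * nat * nat)) : circle R :=
  lattice_circle delta (x.1.1%:Z + signed v.1.1.1 v.2.1.1)
    (x.1.2%:Z + signed v.1.1.2 v.2.1.2) (x.2%:Z + signed v.1.2 v.2.2).

Lemma signed_dist (j j' : nat) : exists e, j'%:Z = j%:Z + signed e `|j%:Z - j'%:Z|%N.
Proof.
exists (j <= j')%N; rewrite /signed; case: leqP => h; lia.
Qed.

(** A pair is recovered from its first circle, one of 8 sign patterns and a triple of the cover.
    Some of these data lead outside the family, which is harmless for an upper bound. *)
Lemma tangent_pairs_card_le (R : realType) (delta : R) (N : nat) :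
  0 < delta -> Num.floor delta^-1 = N%:Z ->
  (card_set [set p : circle R * circle R |
     [/\ circle_family delta p.1, circle_family delta p.2, p.1 <> p.2 & tangent p.1 p.2]]
   <= N ^ 3 * (8 * \sum_(1 <= q < (2 * N).+1) q.+1 * (2 * N %/ q ^ 2)))%N.
Proof.
move=> delta_gt0 floor_N; have [L [sL LP]] := pythagorean_triples_cover N.
pose signs := [seq (e, e3) | e <- [seq (e1, e2) | e1 <- [:: true; false], e2 <- [:: true; false]],
                             e3 <- [:: true; false]].
have sP s : s \in signs by case: s => [[[] []] []].
pose cube := box (iota 1 N) (iota 1 N) (iota 1 N).
pose LL := [seq (nat_circle delta x, shifted_circle delta x v) |
  x <- cube, v <- [seq (s, t) | s <- signs, t <- L]].
have -> : (N ^ 3 * (8 * \sum_(1 <= q < (2 * N).+1) q.+1 * (2 * N %/ q ^ 2)) = size LL)%N.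
  by rewrite size_allpairs size_cube !size_allpairs sL.
apply: card_set_le => -[C C'] /= [].
move=> /(circle_familyP _ floor_N)[j [k [l [h ->]]]].
move=> /(circle_familyP _ floor_N)[j' [k' [l' [h' ->]]]] _.
move=> /(tangent_lattice_circle _ _ _ _ _ _ delta_gt0)[ll' E].
pose v := (`|j%:Z - j'%:Z|%N, `|k%:Z - k'%:Z|%N, `|l%:Z - l'%:Z|%N).
have [e1 E1] := signed_dist j j'; have [e2 E2] := signed_dist k k'.
have [e3 E3] := signed_dist l l'.
apply/allpairsP; exists ((j, k, l), ((e1, e2, e3), v)).
split.
- exact: grid_cube.
- apply/allpairsP; exists ((e1, e2, e3), v).
  split; [exact: sP | apply: LP | by []].
    by apply/eqP; rewrite -eqz_nat PoszD -!abszX !gez0_abs ?sqr_ge0//; apply/eqP.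
  by move: h h'; rewrite /grid/=; clear -ll'; lia.
- by rewrite /shifted_circle /= -E1 -E2 -E3.
Qed.

Lemma finite_circle_pairs (R : realType) (delta : R) (P : circle R * circle R -> Prop) :
  (forall p, P p -> circle_family delta p.1 /\ circle_family delta p.2) -> finite_set [set p | P p].
Proof.
move=> h; apply: (@sub_finite_set _ _ (circle_family delta `*` circle_family delta)) => [p /h//|].
by apply: finite_setX; exact: finite_circle_family.
Qed.

(** The first circle lies in a box of side $Q$ with smallest indices. As $c\le4K\le Q$, adding any
    triple of the window stays in the family, and the distance $2c\delta$ lies between $2K\delta$
    and $2N\delta$. *)
Lemma far_pairs_card_ge (R : realType) (delta : R) (N Q K : nat) (a b : R) :
  0 < delta -> Num.floor delta^-1 = N%:Z ->
  (4 * Q <= N)%N -> (4 * K <= Q)%N ->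
  a <= 2 * K%:R * delta -> 2 * N%:R * delta <= b ->
  (Q ^ 3 * \sum_(1 <= s < K.+1) totient s * (K %/ s ^ 2) <=
   card_set [set p : circle R * circle R |
     [/\ circle_family delta p.1, circle_family delta p.2, tangent p.1 p.2 &
     (a <= circle_dist p.1 p.2 <= b)%R]])%N.
Proof.
move=> delta_gt0 floor_N QN KQ aK bN; have [L [uL sL LP]] := pythagorean_triples_window K.
pose B := box (iota 1 Q) (iota 1 Q) (iota (uphalf N) Q).
pose f (x v : nat * nat * nat) :=
  (nat_circle delta x, nat_circle delta (x.1.1 + v.1.1, x.1.2 + v.1.2, x.2 + v.2)%N).
have -> : (Q ^ 3 * \sum_(1 <= s < K.+1) totient s * (K %/ s ^ 2) =
    size [seq f x v | x <- B, v <- L])%N.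
  by rewrite size_allpairs sL size_box !size_iota !expnS muln1 mulnA.
apply: card_set_ge.
- by apply: (@finite_circle_pairs _ delta) => p [].
- apply: allpairs_uniq => //; first by rewrite uniq_box ?iota_uniq.
  move=> [[[j k] l] [[a1 b1] c1]] [[[j' k'] l'] [[a2 b2] c2]] _ _ E.
  have [Ej Ek El] : (j, k, l) = (j', k', l').
    by apply: (nat_circle_inj delta_gt0); exact: (congr1 fst E).
  have := nat_circle_inj delta_gt0 (congr1 snd E); rewrite /= Ej Ek El.
  by move=> [/addnI-> /addnI-> /addnI->].
- move=> _ /allpairsP[[[[j k] l] [[a1 b1] c1]] [/= hx /LP[pyth hc] ->]].
  move: hx; rewrite mem_box !mem_iota => hx.
  have ac : (a1 <= c1)%N by rewrite -(@leq_exp2r _ _ 2)// -pyth leq_addr.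
  have bc : (b1 <= c1)%N by rewrite -(@leq_exp2r _ _ 2)// -pyth leq_addl.
  have tg : tangent (nat_circle delta (j, k, l)) (nat_circle delta (j + a1, k + b1, l + c1)%N).
    apply/(tangent_lattice_circle _ _ _ _ _ _ delta_gt0) => /=; split; first by lia.
    have sub (u v : nat) : u%:Z - (u + v)%N%:Z = - v%:Z by lia.
    by rewrite !sub !sqrrN; clear -pyth; lia.
  split=> //=.
  + by apply/(grid_circle _ _ _ delta_gt0 floor_N); rewrite /grid/=; clear -hx QN; lia.
  + by apply/(grid_circle _ _ _ delta_gt0 floor_N); rewrite /grid/=; clear -hx ac bc hc QN KQ; lia.
  + rewrite (circle_dist_lattice delta_gt0 tg) /=.
    have -> : `|l%:Z - (l + c1)%N%:Z| = c1%:Z by lia.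
    rewrite -pmulrn; apply/andP; split.
      apply: le_trans aK _; rewrite ler_pM2r// ler_pM2l// ler_nat; lia.
    apply: le_trans _ bN; rewrite ler_pM2r// ler_pM2l// ler_nat; lia.
Qed.

Lemma one_fold_points_card_ge (R : realType) (delta : R) (N Q w : nat) :
  0 < delta -> Num.floor delta^-1 = N%:Z ->
  (4 * Q <= N)%N -> (0 < w)%N ->
  (288 * w ^ 2 <= Q)%N ->
  (4 * (w ^ 2) ^ 4 <= card_set [set S | fold_point (circle_family delta) 1 S])%N.
Proof.
move=> delta_gt0 floor_N QN w0 wQ; have [L [uL sL LP]] := primitive_pythagorean_triples w0.
set W := (w ^ 2)%N in wQ sL LP *.
pose B := box (iota 1 W) (iota 1 W) (iota 0 W).
(* Here [x.2] is the gap between the larger radius index and $N$: with $l=N-c-x$, the condition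
   $N<l+2c$ becomes $x<c$. It holds since $x<W$ and $c\ge a\ge2W$. *)
pose base (x v : nat * nat * nat) := (x.1.1, x.1.2, N - v.2 - x.2)%N.
pose f (x v : nat * nat * nat) : set (circle R) :=
  [set nat_circle delta (base x v);
       nat_circle delta (x.1.1 + v.1.1, x.1.2 + v.1.2, N - v.2 - x.2 + v.2)%N].
apply: (@leq_trans (size [seq f x v | x <- B, v <- L])).
  rewrite size_allpairs size_box !size_iota.
  apply: (@leq_trans (W * W * W * (4 * W))); last by rewrite leq_mul2l sL orbT.
  by rewrite !expnS; lia.
have W0 : (0 < W)%N by rewrite expn_gt0 w0.
have facts j k x a b c : (j, k, x) \in B -> (a, b, c) \in L ->
   [/\ 0 < j <= a, 0 < k, x < c & [/\ 0 < c, a <= c, b <= c, 4 * c <= N & k + c <= N]]%N.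
  rewrite mem_box !mem_iota => hx /LP[pyth _ ha hc].
  have ac : (a <= c)%N by rewrite -(@leq_exp2r _ _ 2)// -pyth leq_addr.
  have bc : (b <= c)%N by rewrite -(@leq_exp2r _ _ 2)// -pyth leq_addl.
  clear -hx ha hc ac bc W0 wQ QN; split; try lia.
  by split; lia.
apply: card_set_ge.
- apply: sub_finite_set (finite_subsets (finite_circle_family delta)).
  by move=> S [].
- apply: allpairs_uniq => //; first by rewrite uniq_box ?iota_uniq.
  move=> [[[j k] x] [[a b] c]] [[[j' k'] x'] [[a' b'] c']].
  move=> /allpairsP[[? ?] [/= hx hv [? ?]]] /allpairsP[[? ?] [/= hx' hv' [? ?]]]; subst.
  have {hx hv} [hj hk xc [c0 ac bc cN kN]] := facts _ _ _ _ _ _ hx hv.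
  have {hx' hv'} [hj' hk' xc' [c0' ac' bc' cN' kN']] := facts _ _ _ _ _ _ hx' hv'.
  rewrite /f /base /= => /pair_set_eq[] [].
    move=> /(lattice_circle_inj delta_gt0)[/= [->] [->] [El]].
    move=> /(lattice_circle_inj delta_gt0)[/= [/addnI ->] [/addnI ->] [El']].
    have -> : c = c' by clear -El El'; lia.
    by have -> : x = x' by clear -El El' xc xc' ac cN cN' c0; lia.
  (* A crossed identification would make the larger radius of each pair the smaller radius of the
     other. *)
  move=> /(lattice_circle_inj delta_gt0)[/= _ _ [El]].
  move=> /(lattice_circle_inj delta_gt0)[/= _ _ [El']].
  by exfalso; clear -El El' c0 c0'; lia.
- move=> S /allpairsP[[[[j k] x] [[a b] c]] [/= hx hv ->]].
  have [hj hk xc [c0 ac bc cN kN]] := facts _ _ _ _ _ _ hx hv.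
  have [pyth g1 _ _] := LP _ _ _ hv.
  apply: (pair_fold_point delta_gt0 floor_N) => //=; clear -hj hk xc c0 ac bc cN kN; lia.
Qed.

(** * Comparison with powers of the cardinality *)

Lemma powR_four_thirds_cube (R : realType) (x : R) : 0 <= x ->
  (x ^+ 3) `^ (4 / 3) = x ^+ 4.
Proof.
move=> x0; rewrite -!powR_mulrn// -powRrM; congr (_ `^ _).
by rewrite mulrCA mulfV ?mulr1// pnatr_eq0.
Qed.

Lemma ln_nat_ge1 (R : realType) (n : nat) : (4 <= n)%N -> 1 <= ln n%:R :> R.
Proof.
(* From $\ln(1-1/2)\le-1/2$; then $\ln4=2\ln2\ge1$. *)
move=> n4; have l2 : 2^-1 <= ln 2 :> R.
  have : ln (1 - 2^-1) <= - 2^-1 :> R by apply: le_ln1Dx; lra.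
  have -> : 1 - 2^-1 = 2^-1 :> R by lra.
  by rewrite lnV ?posrE// lerN2.
apply: (@le_trans _ _ (ln (2 ^+ 2))).
  by rewrite lnXn// mulr2n; lra.
by rewrite ler_ln ?posrE ?exprn_gt0// ?ltr0n ?(leq_trans _ n4)// -natrX ler_nat.
Qed.

Lemma ln_natX_le (R : realType) (m n k : nat) : (0 < m)%N -> (m <= n ^ k)%N ->
  ln m%:R <= k%:R * ln n%:R :> R.
Proof.
move=> m0 mn; have n0 : (0 < n ^ k)%N by apply: leq_trans mn.
have [/eqP k0|k0] := posnP k.
  by move: mn; rewrite (eqP k0) expn0 mul0r => h; rewrite ln_le0// lern1.
rewrite expn_gt0 (gtn_eqF k0) orbF in n0.
rewrite mulr_natl -lnXn ?ltr0n// ler_ln ?posrE ?exprn_gt0 ?ltr0n//.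
by rewrite -natrX ler_nat.
Qed.

(* Q = floor(N / 4), K = floor(Q / 4) and w = floor(sqrt(Q / 288)). *)
Lemma choose_scales (N : nat) : (1200 <= N)%N -> exists Q K w : nat,
  [/\ 4 * Q <= N, N <= 8 * Q, 4 * K <= Q, Q <= 8 * K &
    [/\ N + 1 <= 32 * K, 8 <= Q, 8 <= K &
      [/\ 0 < w, 288 * w ^ 2 <= Q & Q <= 1152 * w ^ 2]]]%N.
Proof.
move=> N1200; pose Q := (N %/ 4)%N.
have NQ : (4 * Q <= N < 4 * Q.+1)%N.
  by rewrite mulnC leq_divM mulnC ltn_ceil.
have Q288 : (288 <= Q)%N by clearbody Q; lia.
have [w /andP[wlo whi]] := nat_sqrt (Q %/ 288).
have w0 : (0 < w)%N.
  case: (posnP w) whi => // ->; rewrite exp1n ltnS leqn0 => /eqP Q0.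
  by move: Q288; rewrite -divn_gt0// Q0.
have wQ : (288 * w ^ 2 <= Q)%N by rewrite mulnC -leq_divRL.
have Qw : (Q <= 1152 * w ^ 2)%N.
  (* Valid as $w\ge1$; this is the source of $1152=4\cdot288$. *)
  have w2 : (w.+1 ^ 2 <= 4 * w ^ 2)%N.
    by rewrite (_ : 4 * w ^ 2 = (2 * w) ^ 2)%N ?leq_exp2r ?expnMn//; lia.
  have Qc : (Q < (Q %/ 288).+1 * 288)%N by apply: ltn_ceil.
  by move: Qc whi w2; clear; set r := (Q %/ 288)%N; lia.
clearbody Q; exists Q; pose K := (Q %/ 4)%N.
have KQ : (4 * K <= Q < 4 * K.+1)%N.
  by rewrite mulnC leq_divM mulnC ltn_ceil.
clearbody K; exists K, w.
by clear wlo whi; split; try lia; split; try lia.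
Qed.

(** Here $n$ lies between the cubes of $Q$ and $8Q$, and the power $4/3$ turns cubes into fourth
    powers. *)
Lemma powR_card_bounds (R : realType) (Q N n : nat) :
  (N <= 8 * Q)%N -> (Q ^ 3 <= n)%N -> (n <= N ^ 3)%N ->
  (Q%:R : R) ^+ 4 <= (n%:R : R) `^ (4 / 3) <= (8 * Q%:R) ^+ 4.
Proof.
move=> NQ nlo nhi; set q : R := Q%:R; have q0 : 0 <= q by rewrite ler0n.
have q8 : 0 <= 8 * q by rewrite mulr_ge0.
have e0 : 0 <= 4 / 3 :> R by rewrite divr_ge0.
apply/andP; split.
  rewrite -powR_four_thirds_cube// ge0_ler_powR// ?nnegrE ?exprn_ge0//.
  by rewrite -natrX ler_nat.
rewrite -powR_four_thirds_cube// ge0_ler_powR// ?nnegrE ?exprn_ge0//.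
rewrite -natrM -natrX ler_nat; apply: leq_trans nhi _.
by rewrite leq_exp2r.
Qed.

Lemma ln_card_bounds (R : realType) (Q N n : nat) :
  (8 <= Q)%N -> (N <= 8 * Q)%N -> (Q ^ 3 <= n)%N -> (n <= N ^ 3)%N ->
  3 * ln (Q%:R : R) <= ln (n%:R : R) <= 12 * ln (Q%:R : R).
Proof.
move=> Q8 NQ nlo nhi; have Q0 : (0 < Q)%N by apply: leq_trans Q8.
have n0 : (0 < n)%N by apply: leq_trans nlo; rewrite expn_gt0 Q0.
apply/andP; split.
  rewrite mulr_natl -lnXn ?ltr0n// ler_ln ?posrE ?exprn_gt0 ?ltr0n//.
  by rewrite -natrX ler_nat.
apply: ln_natX_le => //; apply: leq_trans nhi _.
(* The 12 comes from $n\le N^3$ and the crude bound $N\le8Q\le Q^4$. *)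
apply: (@leq_trans ((Q * Q ^ 3) ^ 3)); last by rewrite -expnS -expnM leq_pexp2l.
rewrite leq_exp2r//; apply: leq_trans NQ _; rewrite mulnC leq_mul2l.
by rewrite (leq_trans Q8) ?orbT// -[leqLHS]expn1 leq_pexp2l.
Qed.

Lemma tangent_pairs_upper (R : realType) (Q N n S : nat) :
  (8 <= Q)%N -> (N <= 8 * Q)%N -> (Q ^ 3 <= n)%N -> (n <= N ^ 3)%N ->
  (4 <= N)%N ->
  (S <= N ^ 3 * (8 * \sum_(1 <= q < (2 * N).+1) q.+1 * (2 * N %/ q ^ 2)))%N ->
  S%:R <= 64 * 8 ^+ 4 * (n%:R `^ (4 / 3) * ln n%:R) :> R.
Proof.
move=> Q8 NQ nlo nhi N4; rewrite -(ler_nat R) => /le_trans; apply.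
have N0 : (0 < N)%N by apply: leq_trans N4.
set q : R := Q%:R; have lq : 1 <= ln q by apply: ln_nat_ge1; apply: leq_trans Q8.
have Q0 : (0 < Q)%N by apply: leq_trans Q8.
have l2N : ln (2 * N)%:R <= 5 * ln q.
  apply: ln_natX_le; first by rewrite muln_gt0 N0.
  apply: (@leq_trans (2 * (8 * Q))); first by rewrite leq_mul2l NQ.
  apply: (@leq_trans (Q ^ 2 * Q)); last by rewrite -expnSr leq_pexp2l.
  by rewrite mulnA leq_mul2r -mulnn orbC; rewrite (leq_trans (_ : _ <= 8 * 8)%N)// leq_mul.
have S1 := sum_floor_sqr_le R N0.
rewrite natrM natrX natrM.
apply: (@le_trans _ _ (N%:R ^+ 3 * (8 * (4 * N%:R * (6 * ln q))))).
  rewrite ler_wpM2l ?exprn_ge0// ler_wpM2l//; apply: le_trans S1 _.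
  by rewrite ler_wpM2l ?mulr_ge0//; lra.
have [/andP[Alo _] /andP[Llo _]] :=
  (powR_card_bounds R NQ nlo nhi, ln_card_bounds R Q8 NQ nlo nhi).
have N8 : N%:R ^+ 4 <= (8 * q) ^+ 4.
  by rewrite lerXn2r ?nnegrE ?mulr_ge0// -natrM ler_nat.
have lq0 : 0 <= ln q by apply: le_trans lq.
(* Since $8\cdot4\cdot6=64\cdot3$ and $3\ln Q\le\ln n$, the constant is 64 times the $8^4$ lost in
   $N^4\le(8Q)^4$. *)
have -> : N%:R ^+ 3 * (8 * (4 * N%:R * (6 * ln q))) = N%:R ^+ 4 * (64 * (3 * ln q)) by ring.
have -> : 64 * 8 ^+ 4 * (n%:R `^ (4 / 3) * ln n%:R) =
    (8 ^+ 4 * n%:R `^ (4 / 3)) * (64 * ln n%:R) :> R by ring.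
apply: ler_pM; rewrite ?exprn_ge0 ?mulr_ge0//; last by rewrite ler_wpM2l.
by apply: le_trans N8 _; rewrite exprMn ler_wpM2l ?exprn_ge0.
Qed.

(** The factor $8^4\cdot12$ passes from $n$ to $Q$. The factor $128=8\cdot2\cdot8$ comes from
    $Q\le8K$, from $\ln Q\le2\ln K$ (as $8K\le K^2$) and from the totient sum. *)
Lemma far_pairs_lower (R : realType) (Q N n K S : nat) :
  (8 <= Q)%N -> (N <= 8 * Q)%N -> (Q ^ 3 <= n)%N -> (n <= N ^ 3)%N ->
  (8 <= K)%N -> (Q <= 8 * K)%N ->
  (Q ^ 3 * \sum_(1 <= s < K.+1) totient s * (K %/ s ^ 2) <= S)%N ->
  n%:R `^ (4 / 3) * ln n%:R <= 8 ^+ 4 * 12 * 128 * S%:R :> R.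
Proof.
move=> Q8 NQ nlo nhi K8 QK; rewrite -(ler_nat R) natrM natrX => hS.
have K0 : (0 < K)%N by apply: leq_trans K8.
have Q0 : (0 < Q)%N by apply: leq_trans Q8.
set q : R := Q%:R; have lq : 1 <= ln q by apply: ln_nat_ge1; apply: leq_trans Q8.
have lq0 : 0 <= ln q by apply: le_trans lq.
have lK : ln q <= 2 * ln K%:R.
  by apply: ln_natX_le => //; apply: leq_trans QK _; rewrite -mulnn leq_mul2r K8 orbT.
have S1 := sum_totient_floor_sqr_ge R K0.
have [/andP[A0 Ahi] /andP[Llo Lhi]] :=
  (powR_card_bounds R NQ nlo nhi, ln_card_bounds R Q8 NQ nlo nhi).
have q0 : 0 <= q by rewrite ler0n.
apply: (@le_trans _ _ ((8 * q) ^+ 4 * (12 * ln q))).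
  apply: ler_pM; [exact: powR_ge0| |exact: Ahi|exact: Lhi].
  by apply: le_trans Llo; rewrite mulr_ge0.
have -> : (8 * q) ^+ 4 * (12 * ln q) = 8 ^+ 4 * 12 * (q ^+ 3 * (q * ln q)) by ring.
rewrite -[leRHS]mulrA; apply: ler_wpM2l; first by rewrite mulr_ge0 ?exprn_ge0.
apply: (@le_trans _ _ (128 * (q ^+ 3 * (\sum_(1 <= s < K.+1) totient s * (K %/ s ^ 2))%:R))); last first.
  by apply: ler_wpM2l.
rewrite [leRHS]mulrCA; apply: ler_wpM2l; first exact: exprn_ge0.
have : q * ln q <= 8 * K%:R * (2 * ln K%:R).
  by apply: ler_pM => //; rewrite -natrM ler_nat.
by move: S1; set X := _%:R; set Y := ln X; set Z := _%:R; lra.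
Qed.

Lemma one_fold_points_lower (R : realType) (Q N n c W S : nat) :
  (N <= 8 * Q)%N -> (Q ^ 3 <= n)%N -> (n <= N ^ 3)%N ->
  (Q <= c * W)%N -> (W ^ 4 <= S)%N ->
  n%:R `^ (4 / 3) <= (8 * c%:R) ^+ 4 * S%:R :> R.
Proof.
move=> NQ nlo nhi; rewrite -(ler_nat R) natrM => Qw; rewrite -(ler_nat R) natrX => hS.
set q : R := Q%:R in Qw *.
have /andP[_ Ahi] := powR_card_bounds R NQ nlo nhi; apply: le_trans Ahi _.
have q0 : 0 <= q by rewrite ler0n.
apply: (@le_trans _ _ ((8 * c%:R) ^+ 4 * W%:R ^+ 4)); last first.
  by apply: ler_wpM2l => //; rewrite exprn_ge0// mulr_ge0.
rewrite -exprMn lerXn2r ?nnegrE ?mulr_ge0//.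
by rewrite -mulrA ler_wpM2l.
Qed.

(** * Explicit constants and the three estimates *)

Theorem lemma12 (R : realType) :
  exists c1 c2 c3 c4 a b : R,
    [/\ 0 < c1, 0 < c2, 0 < c3 & 0 < c4] /\ 0 < a /\ 0 < b /\
    exists2 delta0 : R, 0 < delta0 &
      forall delta : R, 0 < delta -> delta < delta0 ->
        let F : set (circle R) := circle_family delta in
        let n : R := (card_set F)%:R in
        let pairs : set (circle R * circle R) :=
          [set p | [/\ F p.1, F p.2, p.1 <> p.2 & tangent p.1 p.2]] in
        let far_pairs : set (circle R * circle R) :=
          [set p | [/\ F p.1, F p.2, tangent p.1 p.2 &
                       a <= circle_dist p.1 p.2 <= b]] in
        let one_fold_points : set (set (circle R)) :=
          [set S | fold_point F 1 S] in
        [/\ c1 * (n `^ (4 / 3) * ln n) <= (card_set pairs)%:R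
              <= c2 * (n `^ (4 / 3) * ln n),
            c3 * (n `^ (4 / 3) * ln n) <= (card_set far_pairs)%:R &
            c4 * n `^ (4 / 3) <= (card_set one_fold_points)%:R].
Proof.
pose cf : R := 8 ^+ 4 * 12 * 128; pose co : R := (8 * 1152%:R) ^+ 4.
have cf0 : 0 < cf by rewrite !mulr_gt0 ?exprn_gt0.
have pos (c : nat) : (0 < c)%N -> 0 < (8 * c%:R) ^+ 4 :> R.
  by move=> c0; rewrite exprn_gt0// mulr_gt0// ltr0n.
have co0 : 0 < co by exact: pos.
(* Far pairs are tangent pairs, so both lower bounds share one constant. The range of distances
   comes from $32K\ge N+1>1/\delta$, that is $2K\delta\ge1/16$, and from $2N\delta\le2$. *)
exists cf^-1, (64 * 8 ^+ 4), cf^-1, co^-1, 16^-1, 2.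
split.
  split; [rewrite invr_gt0; exact: cf0| |rewrite invr_gt0; exact: cf0|rewrite invr_gt0; exact: co0].
  by rewrite mulr_gt0 ?exprn_gt0 ?ltr0n.
split; first by rewrite invr_gt0 ltr0n.
split; first exact: ltr0n.
exists 1200^-1; first by rewrite invr_gt0 ltr0n.
move=> delta delta0 delta_lt F n pairs far_pairs one_fold_points.
have dV : 1200 < delta^-1 by rewrite -[ltLHS]invrK ltf_pV2 ?posrE ?invr_gt0 ?ltr0n.
have [N floorN] : exists N : nat, Num.floor delta^-1 = N%:Z.
  exists `|Num.floor delta^-1|%N; rewrite gez0_abs// floor_ge0 invr_ge0 ltW//.
have NdV : N%:R <= delta^-1 by have := floor_le delta^-1; rewrite floorN -pmulrn.
have dVN : delta^-1 < N%:R + 1.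
  by have := floorD1_gt delta^-1; rewrite floorN intrD -pmulrn.
have N1200 : (1200 <= N)%N.
  by rewrite -ltnS -(ltr_nat R) -[N.+1%:R]natr1; apply: lt_trans dV dVN.
have [Q [K [w [QN NQ KQ QK [NK Q8 K8 [w0 wQ Qw]]]]]] := choose_scales N1200.
have nlo := circle_family_card_ge delta0 floorN QN.
have nhi := circle_family_card_le floorN.
have far : cf^-1 * (n `^ (4 / 3) * ln n) <= (card_set far_pairs)%:R.
  rewrite ler_pdivrMl//; apply: (@far_pairs_lower R _ _ _ _ _ Q8 NQ nlo nhi K8 QK).
  apply: (far_pairs_card_ge delta0 floorN QN KQ).
    have : (N + 1)%:R <= (32 * K)%:R :> R by rewrite ler_nat.
    rewrite natrD natrM => h; have : 1 <= 32 * K%:R * delta.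
      by rewrite -ler_pdivrMr// mul1r; apply: le_trans h; exact: ltW.
    lra.
  by rewrite -mulrA ler_piMr// -ler_pdivlMr// mul1r.
split=> //.
- apply/andP; split.
    apply: le_trans far _; rewrite ler_nat; apply: card_set_mono.
      apply: (@sub_finite_set _ _ (F `*` F)) => [p []//|].
      by apply: finite_setX; exact: finite_circle_family.
    by move=> p [Fp1 Fp2 tg _]; split=> //; case: tg.
  apply: (@tangent_pairs_upper R _ _ _ _ Q8 NQ nlo nhi); first by apply: leq_trans N1200.
  exact: tangent_pairs_card_le.
- rewrite ler_pdivrMl//; apply: (@one_fold_points_lower R _ _ _ _ _ _ NQ nlo nhi Qw).
  apply: leq_trans (one_fold_points_card_ge delta0 floorN QN w0 wQ).
  by rewrite leq_pmull.
Qed.
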